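(* Let $s \in (0,1)$ and, for $p \in \mathbb{Z}$, define $$\tilde{T}_{p} = \frac{1}{2\pi} \int_{-\pi}^{\pi} |\xi|^{2s} e^{i p \xi} \, d\xi.$$ Then $$\tilde{T}_{p} = \mathcal{O}\left(\frac{1}{|p|^{1+\min(1,2s)}}\right) \quad \text{as } |p| \to \infty,$$ where the implied constant may depend on $s$ only.
   Context: The numbers $\tilde{T}_p$ are the entries of the stiffness matrix of the spectral approximation of the fractional Laplacian $(-\Delta)^s$ in one dimension. In general dimension $d$ this matrix is defined by $\tilde{T}_{\vec{p}} = \frac{1}{(2\pi)^d}\int_{B_R(0)} |\vec{\xi}|^{2s} e^{i\vec{p}\cdot\vec{\xi}}\, d\vec{\xi}$, $\vec{p}\in\mathbb{Z}^d$, with $R = 2\sqrt{\pi}\,(\Gamma(\frac{d}{2}+1))^{1/d}$; for $d=1$ one has $R=\pi$ and $B_R(0) = (-\pi,\pi)$. *)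

(* Defs.v *)
From Stdlib Require Import Reals ZArith.
From Coquelicot Require Import Coquelicot.

Local Open Scope R_scope.

Definition Cexp (z : C) : C :=
  (exp (Re z) * cos (Im z), exp (Re z) * sin (Im z)).

(* |x|^a for a > 0.  [Rpower 0 a] is 1 in the standard library, because
   [ln 0 = 0]; the value at x = 0 is therefore set to 0 by hand. *)
Definition abs_pow (x a : R) : R :=
  if Req_EM_T x 0 then 0 else Rpower (Rabs x) a.

(* C is viewed as a complete normed space over R.  The instance is explicit
   because the canonical one for C is over C itself. *)
Definition T_tilde (s : R) (p : Z) : C :=
  (RtoC (/ (2 * PI)) *
   RInt (V := C_R_CompleteNormedModule)
     (fun xi : R =>
        RtoC (abs_pow xi (2 * s)) * Cexp (Ci * RtoC (IZR p) * RtoC xi))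
     (- PI) PI)%C.

(* f(p) = O(g(p)) as |p| -> +oo over the integers. *)
Definition bigO_Z (f : Z -> C) (g : Z -> R) : Prop :=
  exists (K : R) (N : Z),
    forall p : Z, (N <= Z.abs p)%Z -> Cmod (f p) <= K * Rabs (g p).

(* Main.v *)
(** By parity the integral is twice that of [x^a cos (q x)] over [0, PI], with
    [a = 2 s] and [q = |p|].  On [0, 1/q] this is trivially at most
    [q^-(1+a)].  On [1/q, PI] two integrations by parts give boundary terms,
    among which the one of order [1/q] at [PI] vanishes because
    [sin (q PI) = 0], and the remaining integral of
    [a (a-1) x^(a-2) cos (q x) / q^2] is dominated by that of its constant-sign
    envelope, whose primitive is explicit.  Everything is [O(q^-(1+a) + q^-2)]. *)
Require Import Defs.
From Stdlib Require Import Reals ZArith Lra.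
From Coquelicot Require Import Coquelicot.

Local Open Scope R_scope.

(** * Bounds and continuity of [|x|^a] *)

Lemma abs_pow_pos (x a : R) : 0 < x -> abs_pow x a = Rpower x a.
Proof.
  intros Hx; unfold abs_pow.
  destruct (Req_EM_T x 0) as [H | _]; [lra | now rewrite Rabs_pos_eq by lra].
Qed.

Lemma abs_pow_opp (x a : R) : abs_pow (- x) a = abs_pow x a.
Proof.
  unfold abs_pow; rewrite Rabs_Ropp.
  destruct (Req_EM_T (- x) 0), (Req_EM_T x 0); try reflexivity; lra.
Qed.

Lemma abs_pow_bounds (x a e : R) :
  0 < a -> Rabs x <= e -> 0 < e -> 0 <= abs_pow x a <= Rpower e a.
Proof.
  intros Ha Hx He; unfold abs_pow.
  destruct (Req_EM_T x 0) as [_ | H].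
  - split; [lra | left; apply exp_pos].
  - split; [left; apply exp_pos |].
    apply Rle_Rpower_l; [lra |].
    split; [now apply Rabs_pos_lt | assumption].
Qed.

Lemma continuous_abs_pow (a x : R) :
  0 < a -> continuous (fun y => abs_pow y a) x.
Proof.
  intros Ha; destruct (Req_dec x 0) as [-> | Hx].
  - intros P [eps HP].
    (* With this radius the bound on [abs_pow] is [eps / 2]; the halving turns that non-strict bound
       into a strict one. *)
    assert (Hd : 0 < Rpower (eps / 2) (/ a)) by apply exp_pos.
    exists (mkposreal _ Hd); intros y Hy; apply HP.
    change (Rabs (y - 0) < Rpower (eps / 2) (/ a)) in Hy.
    rewrite Rminus_0_r in Hy.
    change (Rabs (abs_pow y a - abs_pow 0 a) < eps).
    assert (Heps := cond_pos eps).
    destruct (abs_pow_bounds y a _ Ha (Rlt_le _ _ Hy) Hd) as [H0 H1].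
    rewrite Rpower_mult, Rinv_l, Rpower_1 in H1 by lra.
    replace (abs_pow 0 a) with 0
      by (unfold abs_pow; destruct (Req_EM_T 0 0); congruence).
    rewrite Rminus_0_r, Rabs_pos_eq; lra.
  - apply continuous_ext_loc with (fun y => exp (a * ln (Rabs y))).
    (* The ball of radius [|x|] around [x] misses 0, so the value set by hand is never met. *)
    + exists (mkposreal _ (Rabs_pos_lt _ Hx)); intros y Hy.
      change (Rabs (y - x) < Rabs x) in Hy.
      unfold abs_pow; destruct (Req_EM_T y 0) as [-> | _]; [| reflexivity].
      rewrite Rminus_0_l, Rabs_Ropp in Hy; lra.
    + apply (continuous_comp (fun y => a * ln (Rabs y)) exp);
        [| apply continuous_exp].
      apply (continuous_scal_r a (fun y => ln (Rabs y))).
      apply (continuous_comp Rabs ln); [apply continuous_Rabs |].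
      apply continuity_pt_filterlim, derivable_continuous_pt.
      exists (/ Rabs x); apply derivable_pt_lim_ln; now apply Rabs_pos_lt.
Qed.

Lemma continuous_abs_pow_mult (a x : R) (g : R -> R) :
  0 < a -> ex_derive g x -> continuous (fun y => abs_pow y a * g y) x.
Proof.
  intros Ha Hg.
  apply (continuous_mult (fun y => abs_pow y a) g);
    [now apply continuous_abs_pow |].
  now apply (ex_derive_continuous (K := R_AbsRing) (V := R_NormedModule)).
Qed.

(** * Estimates of the cosine integral *)

(** Both integrations by parts are done at once: [F] collects their boundary terms, and its
    derivative is the integrand plus the remainder [H]. Powers such as [x^(a-1)] are written
    [Rpower x a / x], so that once [Rpower] is unfolded the derivative identities are rational in a
    single exponential and [field] closes them. *)
Lemma is_RInt_power_cos_tail (a q e b l : R) :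
  0 < a -> 0 < q -> 0 < e <= b ->
  is_RInt (fun x => Rpower x a * cos (q * x)) e b l ->
  let F x := Rpower x a * sin (q * x) / q
             + a * (Rpower x a / x) * cos (q * x) / q ^ 2 in
  Rabs (l - (F b - F e)) <= a / q ^ 2 * (Rpower b a / b + Rpower e a / e).
Proof.
  intros Ha Hq Heb Hl F.
  set (c := a * (a - 1) / q ^ 2).
  set (H x := c * (Rpower x a / x ^ 2) * cos (q * x)).
  set (h x := Rpower x a * cos (q * x) + H x).
  assert (Hpos : forall x, Rmin e b <= x <= Rmax e b -> 0 < x)
    by (intros x; rewrite Rmin_left, Rmax_right; lra).
  assert (IF : is_RInt h e b (F b - F e)).
  { apply (is_RInt_derive F h).
    - intros x Hx%Hpos; unfold F, h, H, c, Rpower.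
      auto_derive; [repeat split; lra |]; field; lra.
    - intros x Hx%Hpos.
      apply (ex_derive_continuous (K := R_AbsRing) (V := R_NormedModule)).
      unfold h, H, Rpower; auto_derive; repeat split; try lra; nra. }
  assert (IH : is_RInt H e b (F b - F e - l)).
  { eapply is_RInt_ext; [| exact (is_RInt_minus _ _ _ _ _ _ IF Hl)].
    intros x _; unfold h, minus, plus, opp; simpl; ring. }
  set (G x := a / q ^ 2 * (Rpower x a / x)).
  set (g x := c * (Rpower x a / x ^ 2)).
  assert (IG : is_RInt g e b (G b - G e)).
  { apply (is_RInt_derive G g).
    - intros x Hx%Hpos; unfold G, g, c, Rpower.
      auto_derive; [repeat split; lra |]; field; lra.
    - intros x Hx%Hpos.
      apply (ex_derive_continuous (K := R_AbsRing) (V := R_NormedModule)).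
      unfold g, Rpower; auto_derive; repeat split; try lra; nra. }
  assert (Gpos : forall x, 0 < x -> 0 < G x).
  { intros x Hx; unfold G, Rdiv.
    repeat apply Rmult_lt_0_compat; try apply Rinv_0_lt_compat;
      try apply exp_pos; auto using pow_lt. }
  assert (Gb := Gpos b ltac:(lra)); assert (Ge := Gpos e ltac:(lra)).
  replace (a / q ^ 2 * _) with (G b + G e) by (unfold G; ring).
  rewrite <- Rabs_Ropp.
  replace (- (l - (F b - F e))) with (F b - F e - l) by ring.
  assert (Hcos : forall x, Rabs (H x) <= Rabs (g x)).
  { intros x; unfold H, g; rewrite (Rabs_mult _ (cos _)).
    rewrite <- (Rmult_1_r (Rabs (c * _))) at 2.
    apply Rmult_le_compat_l; [apply Rabs_pos |].
    apply Rabs_le, COS_bound. }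
  assert (Hsgn : forall x, 0 < x -> 0 < Rpower x a / x ^ 2).
  { intros x Hx; apply Rdiv_lt_0_compat; [apply exp_pos | now apply pow_lt]. }
  (* The sign of [c], that of [a - 1], decides whether the envelope [|g|] integrates to [G b - G e]
     or to its opposite. As [G] is positive, [G b + G e] bounds both. *)
  destruct (Rle_dec 0 c) as [Hc | Hc].
  - assert (B : Rabs (F b - F e - l) <= G b - G e); [| lra].
    refine (norm_RInt_le H g e b _ _ (proj2 Heb) _ IH IG).
    intros x Hx; change (Rabs (H x) <= g x).
    rewrite <- (Rabs_pos_eq (g x)); [apply Hcos |].
    apply Rmult_le_pos; [lra | left; apply Hsgn; lra].
  - assert (B : Rabs (F b - F e - l) <= - (G b - G e)); [| lra].
    refine (norm_RInt_le H (fun x => - g x) e b _ _ (proj2 Heb) _ IH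
              (is_RInt_opp _ _ _ _ IG)).
    intros x Hx; change (Rabs (H x) <= - g x).
    rewrite <- Rabs_left1; [apply Hcos |].
    assert (H0 := Hsgn x ltac:(lra)); unfold g; nra.
Qed.

(** The constant adds up as follows: 1 from [[0, 1/q]], [1 + a] from the boundary terms at [1/q],
    [a * (Rpower PI a / PI)] from the one left at [PI], and [a + a * (Rpower PI a / PI)] from the
    remainder. *)
Lemma is_RInt_abs_pow_cos_bound (a q l : R) :
  0 < a -> 1 <= q -> sin (q * PI) = 0 ->
  is_RInt (fun x => abs_pow x a * cos (q * x)) 0 PI l ->
  Rabs l <= (2 + 2 * a + 2 * a * (Rpower PI a / PI))
            / Rpower q (1 + Rmin 1 a).
Proof.
  intros Ha Hq Hsin Hl.
  assert (HPI : 1 < PI) by (generalize PI2_1; lra).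
  set (e := / q).
  assert (He : 0 < e) by (apply Rinv_0_lt_compat; lra).
  assert (Heq : e * q = 1) by (apply Rinv_l; lra).
  assert (HeP : e <= PI) by nra.
  set (f x := abs_pow x a * cos (q * x)).
  assert (Hf : forall u v, ex_RInt f u v).
  { intros u v; apply (ex_RInt_continuous (V := R_CompleteNormedModule)).
    intros x _; apply (continuous_abs_pow_mult a x (fun y => cos (q * y)) Ha).
    now auto_derive. }
  destruct (Hf 0 e) as [l1 H1], (Hf e PI) as [l2 H2].
  assert (El : l = l1 + l2).
  { rewrite <- (is_RInt_unique _ _ _ _ Hl).
    apply is_RInt_unique; exact (is_RInt_Chasles _ _ _ _ _ _ H1 H2). }
  set (E := Rpower e a).
  assert (HE : 0 < E) by apply exp_pos.
  assert (B1 : Rabs l1 <= e * E).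
  { replace (e * E) with ((e - 0) * E) by ring.
    refine (norm_RInt_le_const f 0 e l1 E (Rlt_le _ _ He) _ H1).
    intros x Hx; change (Rabs (f x) <= E).
    unfold f; rewrite Rabs_mult.
    destruct (abs_pow_bounds x a e Ha) as [P0 P1];
      [rewrite Rabs_pos_eq; lra | lra |].
    rewrite (Rabs_pos_eq _ P0), <- (Rmult_1_r E).
    apply Rmult_le_compat; auto using Rabs_pos.
    apply Rabs_le, COS_bound. }
  assert (H2' : is_RInt (fun x => Rpower x a * cos (q * x)) e PI l2).
  { apply is_RInt_ext with f; [| exact H2].
    intros x; rewrite Rmin_left by lra; intros Hx.
    unfold f; rewrite abs_pow_pos; [reflexivity | lra]. }
  assert (B2 := is_RInt_power_cos_tail a q e PI l2 Ha ltac:(lra)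
                  (conj He HeP) H2').
  cbv beta zeta in B2; rewrite Hsin in B2; fold E in B2.
  set (M := Rpower PI a / PI) in *.
  assert (HM : 0 < M) by (apply Rdiv_lt_0_compat; [apply exp_pos | lra]).
  (* [P] is the target rate. Every term will be a multiple of [e * E = q^-(1+a)] or of [e^2 = q^-2],
     and both are at most [P] because [q >= 1]. *)
  set (P := / Rpower q (1 + Rmin 1 a)).
  assert (Ee : e = Rpower q (-1))
    by (change (-1) with (- (1)); unfold e; rewrite Rpower_Ropp, Rpower_1; lra).
  assert (HeE : e * E <= P).
  { unfold P, E.
    rewrite Ee, Rpower_mult, <- Rpower_plus, <- Rpower_Ropp.
    apply Rle_Rpower; [lra |].
    generalize (Rmin_r 1 a); lra. }
  assert (Hee : e ^ 2 <= P).
  { unfold P.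
    rewrite <- Rpower_pow, Ee, Rpower_mult, <- Rpower_Ropp by lra.
    apply Rle_Rpower; [lra |].
    generalize (Rmin_l 1 a); simpl; lra. }
  set (C1 := cos (q * PI)) in B2.
  set (C2 := cos (q * e)) in B2.
  set (S := sin (q * e)) in B2.
  assert (HC1 : Rabs C1 <= 1) by apply Rabs_le, COS_bound.
  assert (HC2 : Rabs C2 <= 1) by apply Rabs_le, COS_bound.
  assert (HS : Rabs S <= 1) by apply Rabs_le, SIN_bound.
  replace (a / q ^ 2 * _) with (a * M * e ^ 2 + a * (e * E)) in B2
    by (unfold e; field; lra).
  replace (l2 - _)
    with (l2 - (a * M * e ^ 2 * C1 - e * E * S - a * (e * E) * C2)) in B2
    by (unfold e; field; lra).
  assert (Hscale : forall u v w, 0 <= u <= w -> Rabs v <= 1 ->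
                     - w <= u * v <= w).
  { intros u v w Hu Hv; apply Rabs_le_between in Hv; nra. }
  assert (HeE0 : 0 < e * E) by now apply Rmult_lt_0_compat.
  assert (Hee0 : 0 < e ^ 2) by now apply pow_lt.
  assert (HaM : 0 < a * M) by now apply Rmult_lt_0_compat.
  assert (HaMe : 0 <= a * M * e ^ 2 <= a * M * P) by (split; nra).
  assert (HaE : 0 <= a * (e * E) <= a * P) by (split; nra).
  assert (T1 := Hscale _ C1 _ HaMe HC1).
  assert (T2 := Hscale _ C2 _ HaE HC2).
  assert (T3 := Hscale (e * E) S P ltac:(lra) HS).
  unfold Rdiv; fold P.
  apply Rabs_le_between in B1; apply Rabs_le_between in B2.
  rewrite El; apply Rabs_le; lra.
Qed.

Lemma is_RInt_even_odd (f g : R -> R) (b l : R) :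
  (forall x, f (- x) = f x) -> (forall x, g (- x) = - g x) ->
  ex_RInt g 0 b -> is_RInt f 0 b l ->
  is_RInt f (- b) b (2 * l) /\ is_RInt g (- b) b 0.
Proof.
  intros Hf Hg [m Ig] If.
  (* Reflection: the sign from reversing the bounds cancels the one from substituting [- x]. *)
  assert (Hopp : forall (h : R -> R) k, is_RInt h 0 b k ->
            is_RInt (fun x : R => h (- x)) (- b) 0 k).
  { intros h k Hk.
    assert (J : is_RInt h (- - b) (- 0) (opp k)).
    { rewrite Ropp_involutive, Ropp_0; now apply is_RInt_swap. }
    apply is_RInt_comp_opp, is_RInt_opp in J.
    rewrite opp_opp in J.
    eapply is_RInt_ext; [| exact J].
    intros x _; apply opp_opp. }
  split.
  - replace (2 * l) with (plus l l) by (unfold plus; simpl; ring).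
    apply (is_RInt_Chasles (V := R_NormedModule) f _ 0); [| assumption].
    apply is_RInt_ext with (fun x => f (- x)); auto.
  - replace 0 with (plus (opp m) m) by (unfold plus, opp; simpl; ring).
    apply (is_RInt_Chasles (V := R_NormedModule) g _ 0); [| assumption].
    assert (J := is_RInt_opp (V := R_NormedModule) (fun x => g (- x)) _ _ _
                   (Hopp g m Ig)).
    eapply is_RInt_ext; [| exact J].
    intros x _; change (- g (- x) = g x); rewrite Hg; ring.
Qed.

(** * From the complex integral to the cosine integral *)

Lemma Cexp_Ci (q x : R) :
  Cexp (Ci * RtoC q * RtoC x)%C = (cos (q * x), sin (q * x)).
Proof.
  unfold Cexp, Re, Im; simpl.
  replace ((0 * q - 1 * 0) * x - (0 * 0 + 1 * q) * 0) with 0 by ring.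
  replace ((0 * q - 1 * 0) * 0 + (0 * 0 + 1 * q) * x) with (q * x) by ring.
  now rewrite exp_0, !Rmult_1_l.
Qed.

(** The complex integral is taken componentwise: the even real part gives [2 * l], the odd imaginary
    part gives 0, and the prefactor [/ (2 * PI)] leaves [l / PI]. Since cosine is even, the
    frequency can be taken as [|p|], which suits the estimate for [q >= 1]. *)
Lemma T_tilde_cos (s : R) (p : Z) :
  0 < s ->
  exists l, is_RInt (fun x => abs_pow x (2 * s) * cos (Rabs (IZR p) * x)) 0 PI l
            /\ T_tilde s p = RtoC (l / PI).
Proof.
  intros Hs; assert (Ha : 0 < 2 * s) by lra.
  assert (HPI := PI_RGT_0).
  set (f x := abs_pow x (2 * s) * cos (IZR p * x)).
  set (g x := abs_pow x (2 * s) * sin (IZR p * x)).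
  assert (If : ex_RInt f 0 PI).
  { apply (ex_RInt_continuous (V := R_CompleteNormedModule)); intros x _.
    apply (continuous_abs_pow_mult _ x (fun y => cos (IZR p * y)) Ha).
    now auto_derive. }
  assert (Ig : ex_RInt g 0 PI).
  { apply (ex_RInt_continuous (V := R_CompleteNormedModule)); intros x _.
    apply (continuous_abs_pow_mult _ x (fun y => sin (IZR p * y)) Ha).
    now auto_derive. }
  destruct If as [l Hl]; exists l; split.
  - apply is_RInt_ext with f; [| exact Hl].
    intros x _; unfold f; f_equal.
    unfold Rabs; destruct (Rcase_abs (IZR p)); [| reflexivity].
    rewrite <- Ropp_mult_distr_l; symmetry; apply cos_neg.
  - destruct (is_RInt_even_odd f g PI l) as [J K]; auto.
    + intros x; unfold f; rewrite abs_pow_opp, <- Ropp_mult_distr_r.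
      now rewrite cos_neg.
    + intros x; unfold g; rewrite abs_pow_opp, <- Ropp_mult_distr_r, sin_neg.
      ring.
    + unfold T_tilde.
      rewrite (is_RInt_unique (V := C_R_CompleteNormedModule) _ _ _ (2 * l, 0)).
      * unfold RtoC, Cmult; simpl; f_equal; field; lra.
      * apply (is_RInt_fct_extend_pair (U := R_NormedModule)
                 (V := R_NormedModule)).
        -- apply is_RInt_ext with f; [| exact J].
           intros x _; rewrite Cexp_Ci; unfold f; simpl; ring.
        -- apply is_RInt_ext with g; [| exact K].
           intros x _; rewrite Cexp_Ci; unfold g; simpl; ring.
Qed.

Theorem proposition2 : forall s : R, 0 < s < 1 ->
  bigO_Z (T_tilde s)
    (fun p : Z => 1 / Rpower (Rabs (IZR p)) (1 + Rmin 1 (2 * s))).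
Proof.
  intros s Hs.
  set (a := 2 * s).
  set (K := 2 + 2 * a + 2 * a * (Rpower PI a / PI)).
  (* The estimate holds for every nonzero [p], hence the threshold 1; the division by [PI] is that
     of [l / PI]. *)
  exists (K / PI), 1%Z; intros p Hp.
  assert (HPI := PI_RGT_0).
  destruct (T_tilde_cos s p) as [l [Hl ->]]; [lra |].
  rewrite <- abs_IZR in Hl |- *.
  (* That [p] is an integer enters here: the sine vanishes at [|p| * PI]. *)
  apply is_RInt_abs_pow_cos_bound in Hl;
    [| lra | now apply IZR_le | apply sin_eq_0_1; now exists (Z.abs p)].
  fold a in Hl |- *; fold K in Hl.
  assert (HR : 0 < Rpower (IZR (Z.abs p)) (1 + Rmin 1 a)) by apply exp_pos.
  rewrite Cmod_R; unfold Rdiv in *.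
  rewrite Rabs_mult, (Rabs_pos_eq (/ PI)), Rmult_1_l, (Rabs_pos_eq (/ Rpower _ _))
    by (left; now apply Rinv_0_lt_compat).
  assert (HI := Rinv_0_lt_compat _ HPI); nra.
Qed.
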